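(* Let $H_1(D)$ and $H_2(D)$ be check matrices, of dimensions $(n-k_1)\times n$ and $(n-k_2)\times n$, corresponding to noncatastrophic, delay-free encoders for classical binary convolutional codes. Suppose the Smith form of $H_1(D)H_2^T(D^{-1})$ is $$H_1(D)H_2^T(D^{-1})=A(D)\begin{bmatrix}\Gamma(D)&0\\0&0\end{bmatrix}B(D),$$ where $A(D)$ is an $(n-k_1)\times(n-k_1)$ matrix, $B(D)$ is an $(n-k_2)\times(n-k_2)$ matrix, $\Gamma(D)$ is a diagonal $c\times c$ matrix whose entries are powers of $D$, and the matrix in brackets has dimension $(n-k_1)\times(n-k_2)$. Then the resulting entanglement-assisted quantum convolutional code, with quantum check matrix $$\left[\left.\begin{array}{c}H_1(D)\\0\end{array}\right|\begin{array}{c}0\\H_2(D)\end{array}\right]$$ and $c$ ebits and $k_1+k_2-n+c$ information qubits per frame, has both a finite-depth encoding circuit and a finite-depth decoding circuit.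
   Context: Classical check matrices. $H_i(D)$ is a matrix over $\mathbb{F}_2[D]$; ''corresponding to a noncatastrophic, delay-free encoder'' means that all invariant factors of $H_i(D)$ over $\mathbb{F}_2[D]$ are equal to $1$. In the Smith form of $H_1(D)H_2^T(D^{-1})$, whose entries lie in the ring $\mathbb{F}_2[D,D^{-1}]$ of Laurent polynomials, $A(D)$ and $B(D)$ are invertible over $\mathbb{F}_2[D,D^{-1}]$. Binary polynomial picture. A family of Pauli sequences on a stream of qubits divided into frames of $m$ qubits, taken up to phase and together with all frame shifts, is described by a matrix $[Z(D)\,|\,X(D)]$ with $m$ columns on each side, one row per generator, entries in $\mathbb{F}_2[D,D^{-1}]$ for finite-weight generators and in $\mathbb{F}_2(D)$ in general. Multiplication of a row by $D^l$ is a shift by $l$ frames. A quantum check matrix is such a matrix whose rows need not commute. Row operations: interchange two rows, add a polynomial multiple of one row to another, multiply a row by a power of $D$ or by a nonzero polynomial (and inverses of these); two matrices are row equivalent if they differ by left multiplication by an invertible matrix over $\mathbb{F}_2(D)$. Finite-depth operations (column operations), used in every frame: CNOT from qubit $i$ to qubit $j\ne i$ delayed by $k\in\mathbb{Z}$ frames (in $X$: add $D^k\cdot$column $i$ to column $j$; in $Z$: add $D^{-k}\cdot$column $j$ to column $i$); Hadamard on qubit $i$ (swap column $i$ of $Z$ with column $i$ of $X$); SWAP of two qubits; delay/advance of qubit $i$ (multiply column $i$ of both $Z$ and $X$ by $D^l$, $l\in\mathbb{Z}$); and compositions. Entanglement-assisted quantum convolutional codes. In each frame the receiver Bob holds $c$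 qubits and the sender Alice holds $n$ qubits. With $k=k_1+k_2-n+c$, the unencoded stream has per frame $c$ ebits (Bell states $(|00\rangle+|11\rangle)/\sqrt2$ between Bob's $c$ qubits and $c$ of Alice's), $n-k-c$ ancilla qubits in state $|0\rangle$ and $k$ information qubits, the latter two types held by Alice. Its stabilizer matrix has, for each ebit, a row with $Z$-entries $1$ on the two qubits of the ebit and a row with $X$-entries $1$ on these two qubits, and, for each ancilla, a row with single $Z$-entry $1$ on it (all other entries $0$). The information-qubit matrix has, for each information qubit, one row that is a single $Z$-entry $1$ and one row that is a single $X$-entry $1$ on that qubit. A finite-depth encoding circuit is a finite sequence of finite-depth operations on Alice's $n$ qubits (acting on both matrices) such that the restriction of the resulting stabilizer matrix to Alice's columns is row equivalent to the quantum check matrix of the code. A finite-depth decoding circuit is a finite sequence of finite-depth operations on all $n+c$ qubits, applied to the encoded stream, after which the information-qubit matrix, modulo adding multiples of rows of the resulting stabilizer matrix, again consists of the operators $Z$ and $X$ (possibly shifted by powers of $D$) on $k$ individual qubits of each frame. *)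

(* Defs.v *)
From HB Require Import structures.
From mathcomp Require Import all_boot all_order all_algebra.
Set Implicit Arguments.
Unset Strict Implicit.
Unset Printing Implicit Defensive.
Import GRing.Theory.
Local Open Scope ring_scope.

Notation poly2 := {poly 'F_2}.

(* F_2(D).  F_2[D, D^-1] is the subring singled out by [is_laurent]. *)
Notation ratD := {fraction {poly 'F_2}}.

Definition polyD (p : poly2) : ratD := FracField.tofrac p.

Definition Dl : ratD := polyD 'X.

(* p(D) |-> p(D^-1) *)
Definition polyDinv (p : poly2) : ratD :=
  (map_poly (fun a : 'F_2 => polyD a%:P) p).[Dl^-1].

Definition is_laurent (x : ratD) : Prop :=
  exists (p : poly2) (e : nat), x = polyD p / Dl ^+ e.

Definition laurent_mx r m (M : 'M[ratD]_(r, m)) : Prop :=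
  forall i j, is_laurent (M i j).

Definition laurent_unit_mx r (M : 'M[ratD]_r) : Prop :=
  laurent_mx M /\
  exists2 N : 'M[ratD]_r, laurent_mx N & M *m N = 1%:M /\ N *m M = 1%:M.

(* [d] lists all minn r m diagonal entries of the Smith form over F_2[D],
   including zeros when the rank is deficient. *)
Definition invariant_factors r m (H : 'M[poly2]_(r, m)) (d : seq poly2) : Prop :=
  [/\ size d = minn r m,
      sorted (fun p q : poly2 => p %| q) d
    & exists (U : 'M[poly2]_r) (V : 'M[poly2]_m),
        [/\ U \in unitmx, V \in unitmx
          & H = U *m (\matrix_(i, j) (d`_i *+ (i == j :> nat))) *m V]].

Definition noncatastrophic_delay_free r m (H : 'M[poly2]_(r, m)) : Prop :=
  exists2 d, invariant_factors H d & all (pred1 1) d.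

(* A matrix [Z(D) | X(D)] on m qubits per frame is an element of
   'M[ratD]_(r, m + m), with Z = lsubmx and X = rsubmx. *)

Inductive fd_op (m : nat) : Type :=
  | CNOT (i j : 'I_m) of i != j & int
  | Hadamard of 'I_m
  | SWAP of 'I_m & 'I_m
  | Delay of 'I_m & int.

Definition fd_act r m (M : 'M[ratD]_(r, m + m)) (o : fd_op m)
    : 'M[ratD]_(r, m + m) :=
  let Z := lsubmx M in
  let X := rsubmx M in
  match o with
  | CNOT i j _ k =>
      row_mx (\matrix_(a, b) (Z a b + (Dl ^ (- k) * Z a j) *+ (b == i)))
             (\matrix_(a, b) (X a b + (Dl ^ k * X a i) *+ (b == j)))
  | Hadamard i =>
      row_mx (\matrix_(a, b) (if b == i then X a b else Z a b))
             (\matrix_(a, b) (if b == i then Z a b else X a b))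
  | SWAP i j => row_mx (xcol i j Z) (xcol i j X)
  | Delay i l =>
      row_mx (\matrix_(a, b) (if b == i then Dl ^ l * Z a b else Z a b))
             (\matrix_(a, b) (if b == i then Dl ^ l * X a b else X a b))
  end.

Definition fd_run r m (s : seq (fd_op m)) (M : 'M[ratD]_(r, m + m)) :=
  foldl (@fd_act r m) M s.

Definition fd_within m (A : pred 'I_m) (o : fd_op m) : bool :=
  match o with
  | CNOT i j _ _ => A i && A j
  | Hadamard i => A i
  | SWAP i j => A i && A j
  | Delay i _ => A i
  end.

(* P is invertible over F_2(D), hence r = r'.  Allowing the two numbers of rows
   to be different expressions avoids casts between equal dimensions. *)
Definition row_equiv r r' m (M : 'M[ratD]_(r, m)) (M' : 'M[ratD]_(r', m)) : Prop :=
  exists (P : 'M[ratD]_(r', r)) (Q : 'M[ratD]_(r, r')),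
    [/\ P *m Q = 1%:M, Q *m P = 1%:M & M' = P *m M].

(* In a frame, qubits 0 .. c-1 are Bob's and qubits c .. c+n-1 are Alice's.
   Before encoding, ebit i is shared by qubits i and c + i, ancilla j is qubit
   c + c + j, and information qubit i is qubit c + (n - k) + i. *)

Definition is_alice c n : pred 'I_(c + n) := fun q => (c <= q)%N.

Definition ebit_rows c n : 'M[ratD]_(c, c + n) :=
  \matrix_(i, q) ((q == i :> nat) || (q == c + i :> nat)%N)%:R.

Definition ancilla_rows c n k : 'M[ratD]_(n - k - c, c + n) :=
  \matrix_(j, q) (q == c + c + j :> nat)%N%:R.

Definition info_rows c n k : 'M[ratD]_(k, c + n) :=
  \matrix_(i, q) (q == c + (n - k) + i :> nat)%N%:R.

Definition unencoded_stab c n k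
    : 'M[ratD]_(c + c + (n - k - c), (c + n) + (c + n)) :=
  col_mx (block_mx (ebit_rows c n) 0 0 (ebit_rows c n))
         (row_mx (ancilla_rows c n k) 0).

Definition unencoded_info c n k : 'M[ratD]_(k + k, (c + n) + (c + n)) :=
  block_mx (info_rows c n k) 0 0 (info_rows c n k).

Definition alice_part r c n (M : 'M[ratD]_(r, (c + n) + (c + n)))
    : 'M[ratD]_(r, n + n) :=
  row_mx (rsubmx (lsubmx M)) (rsubmx (rsubmx M)).

Definition fd_encoder c n k r (Q : 'M[ratD]_(r, n + n))
    (enc : seq (fd_op (c + n))) : Prop :=
  all (fd_within (@is_alice c n)) enc /\
  row_equiv (alice_part (fd_run enc (unencoded_stab c n k))) Q.

(* Z and X on qubit q i, both shifted by l i frames: preservation of the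
   commutation relations forces the two shifts to be equal. *)
Definition shifted_info m k (q : 'I_k -> 'I_m) (l : 'I_k -> int)
    : 'M[ratD]_(k + k, m + m) :=
  let T : 'M[ratD]_(k, m) := \matrix_(i, j) (Dl ^ (l i) *+ (j == q i)) in
  block_mx T 0 0 T.

(* Multiples of stabilizer rows have Laurent polynomial coefficients, i.e. they
   are finite products of frame-shifted stabilizer generators. *)
Definition fd_decoder c n k (enc dec : seq (fd_op (c + n))) : Prop :=
  let S := fd_run dec (fd_run enc (unencoded_stab c n k)) in
  let I := fd_run dec (fd_run enc (unencoded_info c n k)) in
  exists (R : 'M[ratD]_(k + k, c + c + (n - k - c)))
         (q : 'I_k -> 'I_(c + n)) (l : 'I_k -> int),
    [/\ laurent_mx R, injective q & I + R *m S = shifted_info q l].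

Definition css_check_mx n r1 r2 (H1 : 'M[poly2]_(r1, n)) (H2 : 'M[poly2]_(r2, n))
    : 'M[ratD]_(r1 + r2, n + n) :=
  block_mx (map_mx polyD H1) 0 0 (map_mx polyD H2).

(* Main.v *)
Require Import Defs.
From HB Require Import structures.
From mathcomp Require Import all_boot all_order all_algebra.
From mathcomp Require Import generic_quotient perm zify.
Set Implicit Arguments.
Unset Strict Implicit.
Unset Printing Implicit Defensive.
Import GRing.Theory.
Local Open Scope ring_scope.

(* CNOT, SWAP and Delay act on [Z | X] by X |-> X E, Z |-> Z E^-T(D^-1), where E
   ranges over the group generated by elementary matrices, permutations and
   powers of D over F_2[D, D^-1].  This ring is Euclidean with units D^l, so every
   right-invertible Laurent matrix is brought to [1 0] by such an E.

   Write r1 = n - k1 = c + a and r2 = n - k2 = c + b.  Absorbing A, B and Gamma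
   into the rows replaces H1, H2 by h1, h2 with h1 h2^T(D^-1) = [1_c 0; 0 0].
   First bring h2 to [1 0] in the X half.  As the product h1 h2^T(D^-1) is
   invariant, h1 becomes [1_c 0 G1; 0 0 G2] in the Z half; CNOTs clear G1, and G2
   is right-invertible.  Since X vanishes on the last n - r2 qubits, Hadamards
   there move G2 to X, where it is brought to [1_a 0] in turn.  Hadamards on all
   qubits then give the unencoded ebits and ancillas.  Running the operations
   backwards encodes, and running the encoder backwards decodes. *)

(** * The automorphism D |-> D^-1 of F_2(D) *)

Lemma frac_numden (R : idomainType) (x : {fraction R}) :
  x = FracField.tofrac \n_(repr x) / FracField.tofrac \d_(repr x).
Proof.
have dn0 : FracField.tofrac \d_(repr x) != 0 by rewrite tofrac_eq0 denom_ratioP.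
apply: (canRL (mulfK dn0)); rewrite -[x in LHS]reprK; unlock FracField.tofrac.
rewrite -[LHS]FracField.pi_mul; apply/eqmodP; rewrite /= FracField.equivfE.
rewrite /FracField.mulf !numden_Ratio ?oner_neq0 ?mulr1 ?mulf_neq0 ?denom_ratioP ?reprK //.
by rewrite mulrC.
Qed.

Lemma DlE : Dl = polyD 'X. Proof. by []. Qed.

Lemma Dl_neq0 : Dl != 0.
Proof. by rewrite /Dl /polyD tofrac_eq0 polyX_eq0. Qed.

HB.instance Definition _ := GRing.RMorphism.copy polyD (@FracField.tofrac poly2).

Lemma polyDinvE p : polyDinv p = (map_poly (polyD \o polyC) p).[Dl^-1].
Proof. by []. Qed.

Fact polyDinv_is_zmod_morphism : zmod_morphism polyDinv.
Proof. by move=> p q; rewrite !polyDinvE rmorphB hornerD hornerN. Qed.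

Fact polyDinv_is_monoid_morphism : monoid_morphism polyDinv.
Proof.
split=> [|p q]; first by rewrite !polyDinvE rmorph1 hornerC.
by rewrite !polyDinvE rmorphM hornerM.
Qed.

HB.instance Definition _ :=
  GRing.isZmodMorphism.Build poly2 ratD polyDinv polyDinv_is_zmod_morphism.
HB.instance Definition _ :=
  GRing.isMonoidMorphism.Build poly2 ratD polyDinv polyDinv_is_monoid_morphism.

Lemma polyDinvC a : polyDinv a%:P = polyD a%:P.
Proof. by rewrite polyDinvE map_polyC hornerC. Qed.

Lemma polyDinvX : polyDinv 'X = Dl^-1.
Proof. by rewrite polyDinvE map_polyX hornerX. Qed.

(** Clearing the negative powers of D reverses the coefficients of p, up to a factor D, since
    [size p] exceeds the degree by one. *)
Lemma polyDinv_rev (p : poly2) :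
  polyDinv p * Dl ^+ (size p) = polyD (\sum_(i < size p) p`_i *: 'X^(size p - i)).
Proof.
rewrite -{1}[p]coefK poly_def rmorph_sum mulr_suml rmorph_sum; apply: eq_bigr => i _.
rewrite -!mul_polyC !rmorphM !rmorphXn /= polyDinvC polyDinvX -mulrA; congr (_ * _).
have -> : Dl ^+ size p = Dl ^+ (size p - i) * Dl ^+ i by rewrite -exprD subnK 1?ltnW.
by rewrite -DlE mulrCA exprVn mulVf ?mulr1 // expf_neq0 ?Dl_neq0.
Qed.

(** Reversing coefficients loses nothing, so the substitution is injective; this keeps denominators
    nonzero when it is extended to fractions. *)
Lemma polyDinv_eq0 p : (polyDinv p == 0) = (p == 0).
Proof.
apply/eqP/eqP => [p0|->]; last exact: rmorph0.
have /eqP := polyDinv_rev p; rewrite p0 mul0r eq_sym tofrac_eq0 => /eqP q0.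
apply/polyP => i; rewrite coef0; case: (ltnP i (size p)) => [ltip|]; last exact: nth_default.
have := congr1 (fun q : poly2 => q`_(size p - i)) q0.
rewrite coef0 coef_sum (bigD1 (Ordinal ltip)) //= big1 ?addr0.
  by rewrite coefZ coefXn eqxx mulr1.
move=> j neq; rewrite coefZ coefXn; case: eqP => [eq_ij|_]; last exact: mulr0.
by case/eqP: neq; apply: val_inj => /=; have := ltn_ord j; lia.
Qed.

(** The field automorphism D |-> D^-1, evaluated on the representative chosen by the quotient;
    [conjD_frac] shows that the choice is immaterial. *)
Definition conjD (x : ratD) : ratD :=
  polyDinv \n_(repr x) / polyDinv \d_(repr x).

(** Equality of fractions is a cross-multiplied identity of polynomials, which the ring morphism
    [polyDinv] preserves. *)
Lemma conjD_frac p q : q != 0 -> conjD (polyD p / polyD q) = polyDinv p / polyDinv q.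
Proof.
move=> q0; rewrite /conjD; set x := polyD p / polyD q.
have d0 := denom_ratioP (repr x).
apply/eqP; rewrite eqr_div ?polyDinv_eq0 // -!rmorphM; apply/eqP; congr polyDinv.
apply/eqP; rewrite -(tofrac_eq (_ * _)) !tofracM.
by rewrite -eqr_div ?tofrac_eq0 // -frac_numden.
Qed.

Lemma conjD_poly p : conjD (polyD p) = polyDinv p.
Proof. by have := conjD_frac p (oner_neq0 _); rewrite !rmorph1 !divr1. Qed.

Variant frac_spec : ratD -> Prop :=
  FracSpec p q of q != 0 : frac_spec (polyD p / polyD q).

Lemma fracP x : frac_spec x.
Proof. by rewrite [x]frac_numden; apply: FracSpec; apply: denom_ratioP. Qed.

Fact conjD_is_zmod_morphism : zmod_morphism conjD.
Proof.
move=> x y; case: (fracP x) => p q q0; case: (fracP y) => r s s0.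
have -> : polyD p / polyD q - polyD r / polyD s = polyD (p * s - r * q) / polyD (q * s).
  by rewrite -mulNr addf_div ?tofrac_eq0 // rmorphB !rmorphM mulNr.
rewrite !conjD_frac ?mulf_neq0 // -[X in _ = _ + X]mulNr addf_div ?polyDinv_eq0 //.
by rewrite rmorphB !rmorphM mulNr.
Qed.

Fact conjD_is_monoid_morphism : monoid_morphism conjD.
Proof.
split=> [|x y]; first by rewrite -(rmorph1 polyD) conjD_poly !rmorph1.
case: (fracP x) => p q q0; case: (fracP y) => r s s0.
by rewrite mulf_div -!rmorphM !conjD_frac ?mulf_neq0 // !rmorphM mulf_div.
Qed.

HB.instance Definition _ :=
  GRing.isZmodMorphism.Build ratD ratD conjD conjD_is_zmod_morphism.
HB.instance Definition _ :=
  GRing.isMonoidMorphism.Build ratD ratD conjD conjD_is_monoid_morphism.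

Lemma conjD_Dl : conjD Dl = Dl^-1.
Proof. by rewrite DlE conjD_poly polyDinvX. Qed.

Lemma conjD_DlX (l : int) : conjD (Dl ^ l) = Dl ^ (- l).
Proof. by rewrite rmorphXz ?unitfE ?Dl_neq0 //= conjD_Dl exprz_inv. Qed.

Lemma conjDK : involutive conjD.
Proof.
have conjDK_poly p : conjD (polyDinv p) = polyD p.
  rewrite -[p]coefK poly_def !rmorph_sum; apply: eq_bigr => i _.
  rewrite -mul_polyC !rmorphM !rmorphXn /= polyDinvC polyDinvX.
  by rewrite conjD_poly polyDinvC fmorphV /= conjD_Dl invrK.
move=> x; case: (fracP x) => p q q0.
by rewrite conjD_frac // fmorph_div /= !conjDK_poly.
Qed.

(** * The subring of Laurent polynomials *)

Lemma laurent_poly p : is_laurent (polyD p).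
Proof. by exists p, 0; rewrite expr0 divr1. Qed.

Lemma laurent0 : is_laurent 0.
Proof. by rewrite -(rmorph0 polyD); apply: laurent_poly. Qed.

Lemma laurent1 : is_laurent 1.
Proof. by rewrite -(rmorph1 polyD); apply: laurent_poly. Qed.

Lemma laurentM x y : is_laurent x -> is_laurent y -> is_laurent (x * y).
Proof.
move=> [p [e ->]] [q [f ->]]; exists (p * q), (e + f)%N.
by rewrite rmorphM exprD mulf_div.
Qed.

Lemma laurentD x y : is_laurent x -> is_laurent y -> is_laurent (x + y).
Proof.
move=> [p [e ->]] [q [f ->]]; exists (p * 'X^f + q * 'X^e), (e + f)%N.
by rewrite addf_div ?expf_neq0 ?Dl_neq0 // rmorphD !rmorphM !rmorphXn exprD.
Qed.

Lemma laurent_Dl (l : int) : is_laurent (Dl ^ l).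
Proof.
case: l => l; first by rewrite -exprnP -rmorphXn; apply: laurent_poly.
by exists 1, l.+1; rewrite rmorph1 div1r.
Qed.

Lemma laurent_sum I (r : seq I) (P : pred I) (F : I -> ratD) :
  (forall i, P i -> is_laurent (F i)) -> is_laurent (\sum_(i <- r | P i) F i).
Proof. by move=> LF; apply: big_ind => //; [apply: laurent0 | apply: laurentD]. Qed.

Lemma laurent_conjD x : is_laurent x -> is_laurent (conjD x).
Proof.
move=> [p [e ->]]; rewrite fmorph_div rmorphXn /= conjD_Dl exprVn invrK.
apply: laurentM (laurent_Dl e).
rewrite -[p]coefK poly_def !rmorph_sum; apply: laurent_sum => i _.
rewrite -mul_polyC !rmorphM !rmorphXn /= conjD_Dl conjD_poly polyDinvC.
by apply: laurentM (laurent_poly _) _; exists 1, (nat_of_ord i); rewrite rmorph1 div1r exprVn.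
Qed.

(** * Finite-depth operations: linearity, inversion, lifting *)

Lemma addDD (x : ratD) : x + x = 0.
Proof.
rewrite -mulr2n -mulr_natl -(rmorph_nat polyD) -(rmorph_nat polyC).
by rewrite (_ : 2 = 0 :> 'F_2) ?rmorph0 ?mul0r //; apply: val_inj.
Qed.

(** Operations act on columns and so commute with row operations; row equivalences therefore pass
    through circuits. *)
Lemma fd_act_mulmx p r m (P : 'M_(p, r)) (M : 'M_(r, m + m)) (o : fd_op m) :
  fd_act (P *m M) o = P *m fd_act M o.
Proof.
rewrite -[M]hsubmxK mul_mx_row; move: (lsubmx M) (rsubmx M) => Z X.
case: o => [i j nij k|i|i j|i l]; rewrite /fd_act !row_mxKl !row_mxKr mul_mx_row.
- congr row_mx; apply/matrixP=> a b; rewrite !mxE; case: eqP => [->|/eqP/negPf bi];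
    rewrite ?mulr0n ?addr0 ?mulr1n ?mulr_sumr -?big_split; apply: eq_bigr => t _;
    by rewrite !mxE ?eqxx ?bi ?mulr1n ?mulr0n ?addr0 // mulrDr; congr (_ + _); rewrite mulrCA.
- by congr row_mx; apply/matrixP=> a b; rewrite !mxE; case: ifP => bi;
    apply: eq_bigr => t _; rewrite !mxE bi.
- by rewrite !xcolE !mulmxA.
- by congr row_mx; apply/matrixP=> a b; rewrite !mxE; case: ifP => bi;
    rewrite ?mulr_sumr; apply: eq_bigr => t _; rewrite !mxE bi // mulrCA.
Qed.

Lemma fd_run_mulmx p r m (P : 'M_(p, r)) (s : seq (fd_op m)) M :
  fd_run s (P *m M) = P *m fd_run s M.
Proof. by elim: s M => //= o s IHs M; rewrite fd_act_mulmx IHs. Qed.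

Lemma fd_run_cat r m (s1 s2 : seq (fd_op m)) (M : 'M_(r, m + m)) :
  fd_run (s1 ++ s2) M = fd_run s2 (fd_run s1 M).
Proof. exact: foldl_cat. Qed.

(** A delay is undone by the opposite delay; the other operations are involutions, CNOT because the
    characteristic is 2. *)
Definition fd_inv m (o : fd_op m) : fd_op m :=
  if o is Delay i l then Delay i (- l) else o.

Lemma fd_actK r m (o : fd_op m) (M : 'M_(r, m + m)) :
  fd_act (fd_act M o) (fd_inv o) = M.
Proof.
rewrite -[RHS]hsubmxK.
case: o => [i j nij k|i|i j|i l]; rewrite /fd_act !row_mxKl !row_mxKr.
- congr row_mx; apply/matrixP=> a b; rewrite !mxE.
    by rewrite [j == i]eq_sym (negPf nij) mulr0n addr0 -addrA -mulrnDl addDD mul0rn addr0.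
  by rewrite (negPf nij) mulr0n addr0 -addrA -mulrnDl addDD mul0rn addr0.
- by congr row_mx; apply/matrixP=> a b; rewrite !mxE; case: (b == i); rewrite ?mxE.
- by congr row_mx; apply/matrixP=> a b; rewrite !mxE tpermK.
- by congr row_mx; apply/matrixP=> a b; rewrite !mxE; case: (b == i); rewrite ?mxE //;
    rewrite mulrA -exprzDr ?unitfE ?Dl_neq0 // addNr expr0z mul1r.
Qed.

Definition fd_run_inv m (s : seq (fd_op m)) := rev (map (@fd_inv m) s).

Lemma fd_runK r m (s : seq (fd_op m)) (M : 'M_(r, m + m)) :
  fd_run (fd_run_inv s) (fd_run s M) = M.
Proof.
rewrite /fd_run_inv; elim: s M => //= o s IHs M.
by rewrite rev_cons -cats1 fd_run_cat IHs /= fd_actK.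
Qed.

Lemma rshift_neq a m (i j : 'I_m) : i != j -> rshift a i != rshift a j.
Proof. by rewrite (inj_eq (@rshift_inj _ _)). Qed.

(** Action on the last m of a + m qubits. It places Alice's circuit beside Bob's qubits, and also
    serves for circuits that must leave the first columns alone. *)
Definition fd_lift a m (o : fd_op m) : fd_op (a + m) :=
  match o with
  | CNOT i j nij k => CNOT (rshift_neq a nij) k
  | Hadamard i => Hadamard (rshift a i)
  | SWAP i j => SWAP (rshift a i) (rshift a j)
  | Delay i l => Delay (rshift a i) l
  end.

Lemma fd_run_lift a m r (s : seq (fd_op m))
    (Z1 X1 : 'M_(r, a)) (M : 'M_(r, m + m)) :
  fd_run (map (@fd_lift a m) s)
    (row_mx (row_mx Z1 (lsubmx M)) (row_mx X1 (rsubmx M))) =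
  row_mx (row_mx Z1 (lsubmx (fd_run s M))) (row_mx X1 (rsubmx (fd_run s M))).
Proof.
elim: s M => //= o s IHs M; rewrite -IHs; congr fd_run.
case: o => [i j nij k|i|i j|i l]; rewrite /fd_act /= !row_mxKl !row_mxKr;
  congr row_mx; apply/matrixP=> x y; rewrite !mxE;
  case: (split_ordP y) => z -> /=.
all: rewrite ?row_mxEl ?row_mxEr ?eq_lrshift ?eq_rshift ?mulr0n ?addr0 ?mxE ?row_mxEl ?row_mxEr //.
all: rewrite -?(inj_tperm _ _ _ (@rshift_inj _ _)) ?[tperm _ _ (lshift _ _)]tpermD ?eq_rlshift //.
all: by rewrite ?(unsplitK (inl _)) ?(unsplitK (inr _)) ?mxE.
Qed.

(** * Matrices over Laurent polynomials *)

Lemma conj_mulmx r m p (M : 'M_(r, m)) (N : 'M_(m, p)) :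
  map_mx conjD (M *m N) = map_mx conjD M *m map_mx conjD N.
Proof. exact: map_mxM. Qed.

Lemma laurent_mxM r m p (M : 'M_(r, m)) (N : 'M_(m, p)) :
  laurent_mx M -> laurent_mx N -> laurent_mx (M *m N).
Proof.
move=> LM LN i j; rewrite mxE; apply: laurent_sum => t _.
exact: laurentM (LM _ _) (LN _ _).
Qed.

Lemma laurent_nat b : is_laurent (b%:R).
Proof. by rewrite -(rmorph_nat polyD); apply: laurent_poly. Qed.

Lemma laurent_mx0 r m : laurent_mx (0 : 'M_(r, m)).
Proof. by move=> i j; rewrite mxE; apply: laurent0. Qed.

Lemma laurent_mx1 m : laurent_mx (1%:M : 'M_m).
Proof. by move=> i j; rewrite mxE; apply: laurent_nat. Qed.

Lemma laurent_trmx r m (M : 'M_(r, m)) : laurent_mx M -> laurent_mx M^T.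
Proof. by move=> LM i j; rewrite mxE. Qed.

Lemma laurent_mx_conj r m (M : 'M_(r, m)) :
  laurent_mx M -> laurent_mx (map_mx conjD M).
Proof. by move=> LM i j; rewrite mxE; apply: laurent_conjD. Qed.

Lemma laurent_mx_poly r m (M : 'M_(r, m)) : laurent_mx (map_mx polyD M).
Proof. by move=> i j; rewrite mxE; apply: laurent_poly. Qed.

Lemma laurent_row_mx r m p (M : 'M_(r, m)) (N : 'M_(r, p)) :
  laurent_mx M -> laurent_mx N -> laurent_mx (row_mx M N).
Proof. by move=> LM LN i j; case: (split_ordP j) => t ->; rewrite ?row_mxEl ?row_mxEr. Qed.

Lemma laurent_col_mx r m p (M : 'M_(r, m)) (N : 'M_(p, m)) :
  laurent_mx M -> laurent_mx N -> laurent_mx (col_mx M N).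
Proof. by move=> LM LN i j; case: (split_ordP i) => t ->; rewrite ?col_mxEu ?col_mxEd. Qed.

Lemma laurent_block_mx r p m q (M : 'M_(r, m)) (N : 'M_(r, q)) (M' : 'M_(p, m)) (N' : 'M_(p, q)) :
  laurent_mx M -> laurent_mx N -> laurent_mx M' -> laurent_mx N' ->
  laurent_mx (block_mx M N M' N').
Proof. by move=> *; apply: laurent_col_mx; apply: laurent_row_mx. Qed.

Lemma laurent_lsubmx r m p (M : 'M_(r, m + p)) : laurent_mx M -> laurent_mx (lsubmx M).
Proof. by move=> LM i j; rewrite mxE. Qed.

Lemma laurent_rsubmx r m p (M : 'M_(r, m + p)) : laurent_mx M -> laurent_mx (rsubmx M).
Proof. by move=> LM i j; rewrite mxE. Qed.

Lemma laurent_usubmx r m p (M : 'M_(m + p, r)) : laurent_mx M -> laurent_mx (usubmx M).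
Proof. by move=> LM i j; rewrite mxE. Qed.

Lemma laurent_dsubmx r m p (M : 'M_(m + p, r)) : laurent_mx M -> laurent_mx (dsubmx M).
Proof. by move=> LM i j; rewrite mxE. Qed.

(** * Column operations realized by circuits *)

(* E' is E^-T(D^-1). *)
Record realizable m (E E' : 'M[ratD]_m) : Prop := Realizable {
  realizable_laurent : laurent_mx E;
  realizable_laurent_dual : laurent_mx E';
  realizable_dual : E' *m (map_mx conjD E)^T = 1%:M;
  realizable_run : exists s : seq (fd_op m),
    forall r (Z X : 'M_(r, m)), fd_run s (row_mx Z X) = row_mx (Z *m E') (X *m E) }.

Lemma realizable1 m : realizable (1%:M : 'M_m) 1%:M.
Proof.
split; rewrite ?map_mx1 ?trmx1 ?mulmx1 //; try exact: laurent_mx1.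
by exists [::] => r Z X; rewrite !mulmx1.
Qed.

Lemma realizableM m (E1 E1' E2 E2' : 'M_m) :
  realizable E1 E1' -> realizable E2 E2' -> realizable (E1 *m E2) (E1' *m E2').
Proof.
move=> [L1 L1' d1 [s1 r1]] [L2 L2' d2 [s2 r2]]; split; try exact: laurent_mxM.
  by rewrite conj_mulmx trmx_mul -mulmxA (mulmxA E2') d2 mul1mx d1.
by exists (s1 ++ s2) => r Z X; rewrite fd_run_cat r1 r2 !mulmxA.
Qed.

Definition hadamards m : seq (fd_op m) := map (@Hadamard m) (enum 'I_m).

Lemma fd_run_hadamards m r (Z X : 'M_(r, m)) :
  fd_run (hadamards m) (row_mx Z X) = row_mx X Z.
Proof.
have run (l : seq 'I_m) (W Y : 'M_(r, m)) : uniq l ->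
    fd_run (map (@Hadamard m) l) (row_mx W Y) =
    row_mx (\matrix_(a, b) if b \in l then Y a b else W a b)
           (\matrix_(a, b) if b \in l then W a b else Y a b).
  elim: l W Y => [|i l IHl] W Y /=.
    by move=> _; congr row_mx; apply/matrixP => a b; rewrite mxE.
  case/andP=> il ul; rewrite /fd_act !row_mxKl !row_mxKr IHl //.
  congr row_mx; apply/matrixP => a b; rewrite !mxE inE;
    by case: eqP => [->|//]; rewrite (negPf il).
rewrite run ?enum_uniq //; congr row_mx; apply/matrixP => a b;
  by rewrite mxE mem_enum.
Qed.

(** Conjugating a circuit by Hadamards on all qubits exchanges the roles of the Z and X halves; the
    conjugate transpose of the duality relation is the relation for the exchanged pair. *)
Lemma realizable_sym m (E E' : 'M_m) : realizable E E' -> realizable E' E.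
Proof.
move=> [L L' d [s run]]; split=> //.
  have := congr1 (fun M => (map_mx conjD M)^T) d.
  rewrite conj_mulmx trmx_mul map_mx1 trmx1 -map_trmx trmxK -map_mx_comp.
  by rewrite (eq_map_mx _ conjDK) map_mx_id.
exists (hadamards m ++ s ++ hadamards m) => r Z X.
by rewrite !fd_run_cat fd_run_hadamards run fd_run_hadamards.
Qed.

Lemma realizable_unit m (E E' : 'M_m) : realizable E E' -> E *m (map_mx conjD E')^T = 1%:M.
Proof. by move=> /realizable_sym[]. Qed.

Lemma realizable_lift a m (E E' : 'M_m) : realizable E E' ->
  realizable (block_mx 1%:M 0 0 E : 'M_(a + m)) (block_mx 1%:M 0 0 E').
Proof.
move=> [L L' d [s run]]; split.
- by apply: laurent_block_mx => //; [apply: laurent_mx1 | apply: laurent_mx0 | apply: laurent_mx0].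
- by apply: laurent_block_mx => //; [apply: laurent_mx1 | apply: laurent_mx0 | apply: laurent_mx0].
- rewrite map_block_mx tr_block_mx mulmx_block !map_mx1 !map_mx0 !trmx1 !trmx0.
  by rewrite !mulmx0 !mul0mx !mul1mx !addr0 add0r d -scalar_mx_block.
exists (map (@fd_lift a m) s) => r Z X.
rewrite -[Z]hsubmxK -[X]hsubmxK.
have := fd_run_lift s (lsubmx Z) (lsubmx X) (row_mx (rsubmx Z) (rsubmx X)).
rewrite !row_mxKl !row_mxKr => ->; rewrite run !row_mxKl !row_mxKr.
by rewrite !mul_row_block !mulmx1 !mulmx0 !addr0 !add0r.
Qed.

(** Conjugation turns D^l into D^-l, so a delay matrix equals its own inverse conjugate
    transpose. *)
Lemma realizable_delay m (i : 'I_m) (l : int) :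
  let E := diag_mx (\row_b (if b == i then Dl ^ l else 1)) in realizable E E.
Proof.
move=> E.
have LE : laurent_mx E.
  move=> a b; rewrite !mxE; case: (a == b); rewrite ?mulr1n ?mulr0n; last exact: laurent0.
  by case: ifP => _; [apply: laurent_Dl | apply: laurent1].
split=> //.
  rewrite map_diag_mx tr_diag_mx mulmx_diag -diag_const_mx; congr diag_mx.
  apply/rowP => b; rewrite !mxE; case: ifP => _; rewrite ?rmorph1 ?mulr1 //.
  by rewrite /= conjD_DlX -exprzDr ?unitfE ?Dl_neq0 // subrr expr0z.
exists [:: Delay i l] => r Z X; rewrite /= /fd_act row_mxKl row_mxKr.
by congr row_mx; rewrite mul_mx_diag; apply/matrixP => a b; rewrite !mxE;
  case: ifP => _; rewrite ?mulr1 // mulrC.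
Qed.

Lemma realizable_swap m (i j : 'I_m) : realizable (tperm_mx i j) (tperm_mx i j).
Proof.
have LE : laurent_mx (tperm_mx i j : 'M[ratD]_m).
  by move=> a b; rewrite !mxE; apply: laurent_nat.
split=> //.
  by rewrite map_perm_mx tr_perm_mx -perm_mxM mulgV perm_mx1.
exists [:: SWAP i j] => r Z X; rewrite /= /fd_act row_mxKl row_mxKr.
by rewrite !xcolE.
Qed.

Lemma unipotent_mulmx m (M N : 'M[ratD]_m) : M *m N = 0 ->
  (1%:M + M) *m (1%:M + N) = 1%:M + (M + N).
Proof.
move=> MN; rewrite mulmxDl mul1mx mulmxDr mulmx1 MN addr0 -addrA.
by rewrite [N + M]addrC.
Qed.

Lemma delta_mx_nil m (i j : 'I_m) (x y : ratD) : i != j ->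
  (x *: delta_mx i j) *m (y *: delta_mx i j) = 0 :> 'M_m.
Proof.
by move=> nij; rewrite -scalemxAl -scalemxAr mul_delta_mx_cond eq_sym (negPf nij) mulr0n !scaler0.
Qed.

Lemma mulmx_deltaE (R : pzRingType) r m p (M : 'M[R]_(r, m)) (i : 'I_m) (j : 'I_p) a b :
  (M *m delta_mx i j) a b = M a i *+ (b == j).
Proof.
rewrite mxE (bigD1 i) //= big1 => [|t /negPf ti].
  by rewrite mxE eqxx addr0 mulr_natr.
by rewrite mxE ti mulr0.
Qed.

(** A CNOT with delay k realizes the coefficient D^k, and composing circuits adds coefficients; over
    F_2 every Laurent polynomial is a sum of such powers. *)
Lemma realizable_transvection m (i j : 'I_m) (x : ratD) : i != j -> is_laurent x ->
  realizable (1%:M + x *: delta_mx i j) (1%:M + conjD x *: delta_mx j i).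
Proof.
move=> nij; have nji : j != i by rewrite eq_sym.
pose T y := realizable (1%:M + y *: delta_mx i j) (1%:M + conjD y *: delta_mx j i).
have T0 : T 0 by rewrite /T rmorph0 !scale0r addr0; apply: realizable1.
have TD y z : T y -> T z -> T (y + z).
  move=> /realizableM Ty /Ty{Ty}.
  rewrite (unipotent_mulmx (delta_mx_nil _ _ nij)) (unipotent_mulmx (delta_mx_nil _ _ nji)).
  by rewrite -!scalerDl -rmorphD.
have TDl k : T (Dl ^ k).
  rewrite /T; split.
  - move=> a b; rewrite !mxE; apply: laurentD (laurent_nat _) _.
    exact: laurentM (laurent_Dl _) (laurent_nat _).
  - move=> a b; rewrite !mxE; apply: laurentD (laurent_nat _) _.
    exact: laurentM (laurent_conjD (laurent_Dl _)) (laurent_nat _).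
  - rewrite map_mxD map_mx1 map_mxZ map_delta_mx linearD /= trmx1 linearZ /= trmx_delta.
    rewrite unipotent_mulmx ?delta_mx_nil //.
    by rewrite -scalerDl addDD scale0r addr0.
  exists [:: CNOT nij k] => r Z X; rewrite /= /fd_act row_mxKl row_mxKr.
  rewrite conjD_DlX !mulmxDr !mulmx1 -!scalemxAr.
  by congr row_mx; apply/matrixP => a b; rewrite mxE [in RHS]mxE [in RHS]mxE mulmx_deltaE mulrnAr.
move=> [p [e ->]]; rewrite -/(T _) -[p]coefK poly_def rmorph_sum mulr_suml.
apply: big_ind => // k _; rewrite -mul_polyC rmorphM rmorphXn /= -mulrA.
have -> : Dl ^+ k / Dl ^+ e = Dl ^ (k%:Z - e%:Z).
  by rewrite expfzDr ?Dl_neq0 // -exprnN.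
have [->|->] : p`_k = 0 \/ p`_k = 1.
- by case: p`_k => [[|[|//]] lt2]; [left | right]; apply: val_inj.
- by rewrite rmorph0 mul0r.
by rewrite rmorph1 mul1r.
Qed.

Lemma block_mx_delta_ur (R : pzRingType) p q (x : R) (i : 'I_p) (j : 'I_q) :
  block_mx 1%:M (x *: delta_mx i j) 0 1%:M =
  1%:M + x *: delta_mx (lshift q i) (rshift p j).
Proof.
rewrite delta_mx_ushift delta_mx_rshift -(row_mx0 R q p q) -/(block_mx _ _ _ _).
by rewrite scale_block_mx scalar_mx_block add_block_mx !scaler0 !addr0 add0r.
Qed.

Lemma block_mx_delta_dl (R : pzRingType) p q (x : R) (i : 'I_p) (j : 'I_q) :
  block_mx 1%:M 0 (x *: delta_mx j i) 1%:M =
  1%:M + x *: delta_mx (rshift p j) (lshift q i).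
Proof.
rewrite delta_mx_dshift delta_mx_lshift -(row_mx0 R p p q) -/(block_mx _ _ _ _).
by rewrite scale_block_mx scalar_mx_block add_block_mx !scaler0 !addr0 add0r.
Qed.

(** Block unipotent matrices multiply by adding their corners, so the corner splits into multiples
    of matrix units, each a transvection. *)
Lemma realizable_upper p q (T : 'M_(p, q)) : laurent_mx T ->
  realizable (block_mx 1%:M T 0 1%:M) (block_mx 1%:M 0 (map_mx conjD T)^T 1%:M).
Proof.
pose P (S : 'M_(p, q)) :=
  realizable (block_mx 1%:M S 0 1%:M) (block_mx 1%:M 0 (map_mx conjD S)^T 1%:M).
have P0 : P 0.
  by rewrite /P map_mx0 trmx0 -!scalar_mx_block; apply: realizable1.
have PD S S' : P S -> P S' -> P (S + S').
  move=> /realizableM PS /PS{PS}; rewrite !mulmx_block.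
  rewrite !mulmx0 !mul0mx !mul1mx !mulmx1 !addr0 !add0r.
  by rewrite /P map_mxD linearD addrC.
move=> LT; rewrite -/(P T) [T]matrix_sum_delta.
have PT i j : P (T i j *: delta_mx i j).
  have nij : lshift q i != rshift p j by rewrite eq_lrshift.
  have := realizable_transvection nij (LT i j).
  rewrite /P map_mxZ map_delta_mx linearZ /= trmx_delta.
  by rewrite -block_mx_delta_ur -block_mx_delta_dl.
apply: (big_ind P P0 PD) => i _; apply: (big_ind P P0 PD) => j _; exact: PT.
Qed.

(** Exchanging halves turns the upper case, applied to the conjugate transpose of T, into the lower
    one. *)
Lemma realizable_lower p q (T : 'M_(q, p)) : laurent_mx T ->
  realizable (block_mx 1%:M 0 T 1%:M) (block_mx 1%:M (map_mx conjD T)^T 0 1%:M).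
Proof.
move=> LT; apply: realizable_sym.
have := realizable_upper (laurent_trmx (laurent_mx_conj LT)).
suff -> : (map_mx conjD (map_mx conjD T)^T)^T = T by [].
by apply/matrixP => i j; rewrite !mxE; apply: conjDK.
Qed.

(** * Euclidean reduction over F_2[D, D^-1] *)

Lemma F2_neq0 (a : 'F_2) : a != 0 -> a = 1.
Proof. by case: a => [[|[|//]] lt2] // _; apply: val_inj. Qed.

(** Divisors of X^e are monomials up to a scalar, and the only nonzero scalar of F_2 is 1. *)
Lemma dvdp_Xn_F2 (p : poly2) e : p %| 'X^e -> exists k, p = 'X^k.
Proof.
have X0 : 'X = 'X - (0 : 'F_2)%:P by rewrite subr0.
rewrite X0 => /dvdp_exp_XsubCP[k _ /eqpP[[a b] /= /andP[/F2_neq0-> /F2_neq0->]]].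
by rewrite !scale1r -X0 => ->; exists k.
Qed.

Lemma laurent_unit (x y : ratD) : is_laurent x -> is_laurent y -> x * y = 1 ->
  exists l : int, x = Dl ^ l.
Proof.
move=> [p [e ->]] [q [f ->]]; rewrite mulf_div => /divr1_eq.
rewrite -exprD -rmorphM DlE -rmorphXn => /eqP; rewrite tofrac_eq => /eqP pq.
have [k ->] : exists k, p = 'X^k.
  by apply: (@dvdp_Xn_F2 _ (e + f)); rewrite -pq dvdp_mulr.
by exists (k%:Z - e%:Z); rewrite expfzDr ?Dl_neq0 // -exprnN rmorphXn.
Qed.

Lemma laurent_common_denominator m (v : 'rV[ratD]_m) : laurent_mx v ->
  exists (p : 'rV[poly2]_m) (e : nat), v = (Dl ^+ e)^-1 *: map_mx polyD p.
Proof.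
move=> Lv.
have /fin_all_exists[p /fin_all_exists[e ve]] := Lv 0.
exists (\row_j (p j * 'X^(\sum_(i | i != j) e i))), (\sum_i e i)%N.
apply/rowP => j; rewrite !mxE ve rmorphM rmorphXn [\sum_i e i](bigD1 j) //= exprD -DlE.
by rewrite [in RHS]mulrC invfM mulrACA divff ?mulr1 // expf_neq0 ?Dl_neq0.
Qed.

(** Euclidean algorithm on the entries of a row: while two are nonzero, one of at least equal size
    is reduced modulo the other, and the total size drops. *)
Lemma realizable_euclid m (p : 'rV[poly2]_m.+1) :
  exists (E E' : 'M_m.+1) (i : 'I_m.+1) (q : poly2),
    realizable E E' /\ map_mx polyD p *m E = polyD q *: delta_mx 0 i.
Proof.
have [N] := ubnP (\sum_j size (p 0%R j)); elim: N p => // N IHN p ltN.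
have [/existsP[i /existsP[j /and4P[nij pi0 pj0 ji]]]|none] := boolP
  [exists i, exists j, [&& i != j, p 0 i != 0, p 0 j != 0 & (size (p 0%R j) <= size (p 0%R i))%N]].
  pose x := polyD (- (p 0 i %/ p 0 j)).
  pose p' := p - (p 0 i %/ p 0 j * p 0 j) *: delta_mx 0 i.
  have [|E [E' [k [q [rE pE]]]]] := IHN p'.
    rewrite ltnS in ltN; apply: leq_trans ltN; rewrite (bigD1 i) //= [X in (_ <= X)%N](bigD1 i) //=.
    rewrite -addSn leq_add //.
      have -> : p' 0 i = p 0 i %% p 0 j.
        by rewrite !mxE !eqxx mulr1 {1}(divp_eq (p 0 i) (p 0 j)) addrC addKr.
      by apply: leq_trans ji; rewrite ltn_modp.
    apply: leq_sum => t ti; rewrite !mxE (negPf ti) mulr0 subr0; exact: leqnn.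
  have nji : j != i by rewrite eq_sym.
  exists ((1%:M + x *: delta_mx j i) *m E), ((1%:M + conjD x *: delta_mx i j) *m E'), k, q.
  split; first exact: realizableM (realizable_transvection nji (laurent_poly _)) rE.
  rewrite mulmxA -pE; congr (_ *m _).
  rewrite mulmxDr mulmx1 -scalemxAr; apply/rowP => t.
  rewrite mxE [X in _ + X]mxE mulmx_deltaE !mxE eqxx /= /x !rmorphB !rmorphN !rmorphM.
  by case: (t == i); rewrite ?mulr1n ?mulr0n ?rmorph1 ?rmorph0 ?mulr1 ?mulr0 ?oppr0 // mulNr.
(* Any two sizes are comparable, so a row on which the algorithm stops has at most one nonzero
   entry. *)
have [i [q pE]] : exists i q, p = q *: delta_mx 0 i.
  have [->|/rV0Pn[i pi0]] := eqVneq p 0; first by exists 0, 0; rewrite scale0r.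
  exists i, (p 0 i); apply/rowP => j; rewrite !mxE eqxx /=.
  have [->|nji] := eqVneq j i; first by rewrite mulr1.
  rewrite mulr0; apply/eqP; apply: contraT => pj0; case/negP: none.
  have nij : i != j by rewrite eq_sym.
  have [ji|ij] := leqP (size (p 0 j)) (size (p 0 i)).
    by apply/existsP; exists i; apply/existsP; exists j; rewrite nij pi0 pj0.
  by apply/existsP; exists j; apply/existsP; exists i; rewrite nji pi0 pj0 ltnW.
exists 1%:M, 1%:M, i, q; split; first exact: realizable1.
by rewrite mulmx1 pE map_mxZ map_delta_mx.
Qed.

(** Euclid leaves a single entry; right-invertibility makes it a unit D^l, which a delay removes,
    and a swap moves the remaining 1 to the front. *)
Lemma realizable_unimodular_row m (v : 'rV[ratD]_(1 + m)) :
  laurent_mx v -> (exists2 R : 'cV_(1 + m), laurent_mx R & v *m R = 1%:M) ->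
  exists E E' : 'M_(1 + m), realizable E E' /\ v *m E = row_mx 1%:M 0.
Proof.
move=> Lv [R LR vR].
have [p [e vE]] := laurent_common_denominator Lv.
have [E [E' [i [q [rE pE]]]]] := realizable_euclid p.
have vEE : v *m E = (polyD q / Dl ^+ e) *: delta_mx 0 i.
  by rewrite vE -scalemxAl pE scalerA mulrC.
have [l ul] : exists l : int, polyD q / Dl ^+ e = Dl ^ l.
  (* The inverse of the surviving entry is the i-th entry of E^-1 R, where E^-1 is the conjugate
     transpose of [E']. *)
  apply: (@laurent_unit _ (((map_mx conjD E')^T *m R) i 0)).
  - by exists q, e.
  - apply: (laurent_mxM (laurent_trmx (laurent_mx_conj _)) LR).
    exact: realizable_laurent_dual rE.
  have := congr1 (fun M : 'M_1 => M 0 0) vR.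
  rewrite -[v]mulmx1 -(realizable_unit rE) -2!mulmxA mulmxA vEE.
  rewrite -scalemxAl -rowE !mxE eqxx; exact.
pose d := diag_mx (\row_b (if b == i then Dl ^ (- l) else 1)) : 'M[ratD]_(1 + m).
have vd : v *m (E *m d) = delta_mx 0 i.
  rewrite mulmxA vEE ul mul_mx_diag; apply/rowP => j; rewrite !mxE eqxx /=.
  case: eqP => _; last by rewrite mulr0 mul0r.
  by rewrite mulr1 -expfzDr ?Dl_neq0 // subrr expr0z.
exists (E *m d *m tperm_mx i 0), (E' *m d *m tperm_mx i 0); split.
  apply: realizableM; last exact: realizable_swap.
  by apply: realizableM => //; apply: realizable_delay.
rewrite mulmxA vd -rowE; apply/rowP => j; rewrite !mxE tpermL.
case: split_ordP => t ->; first by rewrite (ord1 t) !mxE.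
by rewrite mxE.
Qed.

Lemma pid_mx_S (R : pzSemiRingType) r m s :
  pid_mx s.+1 = block_mx 1%:M 0 0 (pid_mx s) :> 'M[R]_(1 + r, 1 + m).
Proof.
apply/matrixP => i j; rewrite !mxE.
case: split_ordP => i' ->; rewrite mxE; case: split_ordP => j' ->; rewrite !mxE //.
- by rewrite (ord1 i') (ord1 j').
- by rewrite (ord1 i').
by rewrite (ord1 j').
Qed.

Lemma right_inv_leq (F : fieldType) r m (G : 'M[F]_(r, m)) R : G *m R = 1%:M -> (r <= m)%N.
Proof. by move=> GR; rewrite -(mxrank1 F r) -GR (leq_trans (mxrankM_maxl _ _)) ?rank_leq_col. Qed.

Lemma laurent_right_inv_mulmx r m (G : 'M_(r, m)) (E E' : 'M_m) :
  realizable E E' -> (exists2 R : 'M_(m, r), laurent_mx R & G *m R = 1%:M) ->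
  exists2 R : 'M_(m, r), laurent_mx R & G *m E *m R = 1%:M.
Proof.
move=> rE [R LR GR]; exists ((map_mx conjD E')^T *m R).
  exact: (laurent_mxM (laurent_trmx (laurent_mx_conj (realizable_laurent_dual rE))) LR).
by rewrite mulmxA -(mulmxA G) (realizable_unit rE) mulmx1.
Qed.

(** The upper right block of the product says that G kills the upper right block of R; a left
    inverse of G makes that block zero, so the lower right block of R inverts K. *)
Lemma laurent_right_inv_dr r m p q (G : 'M_(r, m)) (H : 'M_(p, m)) (K : 'M_(p, q)) :
  (exists2 R : 'M_(m + q, r + p), laurent_mx R & block_mx G 0 H K *m R = 1%:M) ->
  (exists2 R : 'M_(m, r), laurent_mx R & R *m G = 1%:M) ->
  exists2 R : 'M_(q, p), laurent_mx R & K *m R = 1%:M.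
Proof. 
move=> [R LR GR] [L _ LG]; exists (drsubmx R).
  exact: laurent_rsubmx (laurent_dsubmx LR).
move: GR; rewrite -[R]submxK mulmx_block scalar_mx_block => /eq_block_mx[_ G0 _].
rewrite mul0mx addr0 in G0; rewrite block_mxKdr.
have -> : ursubmx R = 0 by rewrite -[ursubmx R]mul1mx -LG -mulmxA G0 mulmx0.
by rewrite mulmx0 add0r.
Qed.

(** Induction on the rows: the first row becomes [1 0], the lower right block stays right-invertible
    and is reduced on the remaining columns, and the entries under the pivot are cleared last. *)
Lemma realizable_pid_mx r m (G : 'M[ratD]_(r, m)) : laurent_mx G ->
  (exists2 R : 'M_(m, r), laurent_mx R & G *m R = 1%:M) ->
  exists E E' : 'M_m, realizable E E' /\ G *m E = pid_mx r.
Proof.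
elim: r m G => [|r IHr] [|m] G LG Ginv.
- by exists 1%:M, 1%:M; rewrite [LHS]flatmx0 [RHS]flatmx0; split=> //; apply: realizable1.
- by exists 1%:M, 1%:M; split; [apply: realizable1 | apply/matrixP; case].
- case: Ginv => R _ /matrixP/(_ 0 0); rewrite !mxE big_ord0 => /eqP.
  by rewrite eq_sym oner_eq0.
rewrite -[r.+1]/(1 + r)%N -[m.+1]/(1 + m)%N in G LG Ginv *.
have [E1 [E1' [rE1 E1v]]] : exists E E' : 'M_(1 + m),
    realizable E E' /\ usubmx G *m E = row_mx 1%:M 0.
  apply: realizable_unimodular_row; first exact: laurent_usubmx.
  have [R LR GR] := Ginv; exists (lsubmx R); first exact: laurent_lsubmx.
  move: GR; rewrite -{1}[G]vsubmxK -{1}[R]hsubmxK mul_col_row scalar_mx_block.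
  by case/eq_block_mx.
pose g := dlsubmx (G *m E1); pose G' := drsubmx (G *m E1).
have GE1 : G *m E1 = block_mx 1%:M 0 g G'.
  rewrite -{1}[G]vsubmxK mul_col_mx E1v /block_mx; congr col_mx.
  by rewrite -[LHS]hsubmxK /g /G' /dlsubmx /drsubmx -[in RHS](vsubmxK G) mul_col_mx col_mxKd.
have LGE : laurent_mx (G *m E1) by apply: laurent_mxM (realizable_laurent rE1).
have G'inv : exists2 R : 'M_(m, r), laurent_mx R & G' *m R = 1%:M.
  have := laurent_right_inv_mulmx rE1 Ginv.
  rewrite GE1 => /laurent_right_inv_dr; apply.
  by exists 1%:M; [apply: laurent_mx1 | rewrite mulmx1].
have rm : (r <= m)%N by have [R _ /right_inv_leq] := G'inv.
have [|E2 [E2' [rE2 GE2]]] := IHr m G' (laurent_rsubmx (laurent_dsubmx LGE)).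
  by [].
(* Once the lower right block is [1 0], adding its columns with coefficients -g cancels the column g
   under the pivot; [pid_mx r] pads these coefficients from r to m entries. *)
have LT : laurent_mx (- (pid_mx r *m g) : 'M_(m, 1)).
  rewrite -mulNmx; apply: laurent_mxM (laurent_lsubmx (laurent_dsubmx LGE)).
  by move=> i j; rewrite !mxE -(rmorph_nat polyD) -rmorphN; apply: laurent_poly.
have rE3 := realizable_lower LT.
have := realizableM (realizableM rE1 (realizable_lift 1 rE2)) rE3.
set E := (X in realizable X _); set E' := (X in realizable _ X) => rE.
exists E, E'; split=> //.
pose simp := (mulmx1, mul1mx, mul0mx, mulmx0, addr0, add0r).
rewrite /E !mulmxA GE1 !mulmx_block GE2 !simp.
rewrite mulmxN mulmxA mul_pid_mx minnn (minn_idPr rm) pid_mx_1 mul1mx subrr.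
by rewrite pid_mx_S.
Qed.

(** * The unencoded stream, row equivalence and decoding *)

Lemma rows_submx (F : fieldType) r s m (M : 'M[F]_(r, m)) (N : 'M_(s, m)) :
  (forall i, exists j, M i =1 N j) -> (M <= N)%MS.
Proof.
move=> MN; apply/row_subP => i; have [j Mi] := MN i.
by have -> : row i M = row j N by [apply/rowP => t; rewrite !mxE]; apply: row_sub.
Qed.

(** Seen from Alice's side alone, an ebit is a noncommuting pair Z, X on one qubit; this is what
    lets the rows of the check matrix fail to commute. *)
Lemma alice_part_unencoded c n k :
  alice_part (unencoded_stab c n k) =
  col_mx (block_mx (\matrix_(i, q) (q == i :> nat)%:R) 0 0 (\matrix_(i, q) (q == i :> nat)%:R))
         (row_mx (\matrix_(j, q) (q == c + j :> nat)%N%:R) 0).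
Proof.
apply/matrixP => i t; case: (split_ordP t) => t' ->; rewrite ?row_mxEl ?row_mxEr.
all: case: (split_ordP i) => [i' ->|i' ->].
all: try (case: (split_ordP i') => i'' ->).
all: rewrite ?row_mxEl ?row_mxEr /alice_part /unencoded_stab ?(row_mxEl, row_mxEr) 2!mxE.
all: rewrite ?(col_mxEu, col_mxEd).
all: rewrite ?(block_mxEul, block_mxEur, block_mxEdl, block_mxEdr)
  ?(row_mxEl, row_mxEr) !mxE //=.
all: by congr (nat_of_bool _)%:R; rewrite -?addnA !eqn_add2l // gtn_eqF // ltn_addr.
Qed.

Lemma alice_part_fd_run_lift r c n (s : seq (fd_op n)) (M : 'M_(r, (c + n) + (c + n))) :
  alice_part (fd_run (map (@fd_lift c n) s) M) = fd_run s (alice_part M).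
Proof.
rewrite -[M]hsubmxK -[lsubmx M]hsubmxK -[rsubmx M]hsubmxK.
set Z1 := lsubmx (lsubmx M); set Z2 := rsubmx (lsubmx M).
set X1 := lsubmx (rsubmx M); set X2 := rsubmx (rsubmx M).
have := fd_run_lift s Z1 X1 (row_mx Z2 X2).
rewrite row_mxKl row_mxKr /alice_part => ->.
by rewrite !row_mxKl !row_mxKr hsubmxK.
Qed.

(** If M' = P M is row-free then P has full rank, and the equal numbers of rows make P square, hence
    invertible. *)
Lemma row_equiv_submx r r' m (M : 'M_(r, m)) (M' : 'M_(r', m)) :
  r = r' -> row_free M' -> (M' <= M)%MS -> row_equiv M M'.
Proof.
move=> rr'; subst r' => freeM' /submxP[P M'E].
have uP : P \in unitmx.
  rewrite -row_full_unit -col_leq_rank -{1}(eqP freeM') M'E.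
  exact: mxrankM_maxl.
by exists P, (invmx P); split=> //; rewrite ?mulmxV ?mulVmx.
Qed.

(** Running the circuit backwards restores the unencoded stream, where the information operators
    already sit on single qubits: no stabilizer rows are added and all shifts are 0. *)
Lemma fd_decoder_inv c n k (s : seq (fd_op (c + n))) :
  (k <= n)%N -> fd_decoder k s (fd_run_inv s).
Proof.
move=> kn; rewrite /fd_decoder !fd_runK.
have lt_q (i : 'I_k) : (c + (n - k) + i < c + n)%N by have := ltn_ord i; lia.
exists 0, (fun i => Ordinal (lt_q i)), (fun=> 0); split.
- exact: laurent_mx0.
- by move=> i j [] /addnI /ord_inj.
rewrite mul0mx addr0 /unencoded_info /shifted_info.
suff -> : info_rows c n k = \matrix_(i, j) (Dl ^ 0 *+ (j == Ordinal (lt_q i))) by [].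
by apply/matrixP => i j; rewrite !mxE.
Qed.

(** With all invariant factors 1 the Smith form is U [1 0] V, whose right inverse V^-1 [1 0]^T U^-1
    is polynomial. *)
Lemma noncatastrophic_right_inv r m (H : 'M[poly2]_(r, m)) :
  (r <= m)%N -> noncatastrophic_delay_free H ->
  exists2 R : 'M[ratD]_(m, r), laurent_mx R & map_mx polyD H *m R = 1%:M.
Proof.
move=> rm [d [sd _ [U [V [uU uV HE]]]] /allP d1].
exists (map_mx polyD (invmx V *m pid_mx r *m invmx U)); first exact: laurent_mx_poly.
rewrite -map_mxM HE.
have -> : (\matrix_(i, j) (d`_i *+ (i == j :> nat)) : 'M_(r, m)) = pid_mx r.
  apply/matrixP => i j; rewrite !mxE ltn_ord andbT.
  (* The list of factors has length [minn r m] = r, so the index is in range and the default 0 is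
     never read. *)
  suff /eqP -> : d`_i == 1 by [].
  by apply: d1; rewrite mem_nth // sd (minn_idPl rm).
rewrite !mulmxA mulmxK // -(mulmxA U) mul_pid_mx minnn (minn_idPr rm) pid_mx_1 mulmx1.
by rewrite mulmxV // map_mx1.
Qed.

(** * The encoder, first in normalized form, then for general Smith data *)

Lemma castmx_block_diag_mx c x y a b (G : 'M[ratD]_c)
    (e : ((c + x)%N = (c + a)%N) * ((c + y)%N = (c + b)%N)) :
  castmx e (block_mx G 0 0 0) = block_mx G 0 0 0.
Proof.
case: e => e1 e2; have ea := addnI e1; have eb := addnI e2; subst x y.
by rewrite (eq_irrelevance e1 erefl) (eq_irrelevance e2 erefl) castmx_id.
Qed.

(** Here the product is already normalized. With n = c + b + m, r1 = c + a and r2 = c + b, the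
    number n + c - r1 - r2 of information qubits is m - a. Inclusion of row spaces is enough, since
    the row counts agree. *)
Lemma css_encoder c a b m (h1 : 'M[ratD]_(c + a, (c + b) + m))
    (h2 : 'M[ratD]_(c + b, (c + b) + m)) :
  laurent_mx h1 -> laurent_mx h2 ->
  (exists2 R, laurent_mx R & h1 *m R = 1%:M) ->
  (exists2 R, laurent_mx R & h2 *m R = 1%:M) ->
  h1 *m (map_mx conjD h2)^T = block_mx 1%:M 0 0 0 ->
  (a <= m)%N /\ exists s : seq (fd_op ((c + b) + m)),
    (block_mx h1 0 0 h2 <=
     fd_run s (alice_part (unencoded_stab c ((c + b) + m) (m - a))))%MS.
Proof.
move=> L1 L2 inv1 inv2 h12; pose simp := (mulmx1, mul1mx, mul0mx, mulmx0, addr0, add0r).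
have [E1 [E1' [rE1 h2E]]] := realizable_pid_mx L2 inv2.
rewrite pid_mx_row in h2E.
pose G1 := usubmx (rsubmx (h1 *m E1')); pose G2 := dsubmx (rsubmx (h1 *m E1')).
(* Multiplying by the conjugate transpose of [1 0] reads off the left columns, and duality of [E1]
   and [E1'] identifies the result with h1 h2^T(D^-1). *)
have h1E : h1 *m E1' = row_mx (block_mx 1%:M 0 0 0) (col_mx G1 G2).
  rewrite vsubmxK -[LHS]hsubmxK; congr row_mx; rewrite -h12.
  transitivity (h1 *m E1' *m (map_mx conjD (h2 *m E1))^T); last first.
    by rewrite conj_mulmx trmx_mul mulmxA -(mulmxA h1) (realizable_dual rE1) mulmx1.
  rewrite h2E map_row_mx map_mx1 map_mx0 tr_row_mx trmx1 trmx0.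
  by rewrite -{2}[h1 *m E1']hsubmxK mul_row_col !simp.
have LhE : laurent_mx (h1 *m E1') by apply: laurent_mxM (realizable_laurent_dual rE1).
have LG1 : laurent_mx G1 by apply: laurent_usubmx; apply: laurent_rsubmx.
have LG2 : laurent_mx G2 by apply: laurent_dsubmx; apply: laurent_rsubmx.
have LT : laurent_mx (col_mx (- G1) 0 : 'M_(c + b, m)).
  apply: laurent_col_mx; last exact: laurent_mx0.
  move=> i j; rewrite mxE -[- _]mulN1r.
  by apply: laurentM (LG1 _ _); rewrite -(rmorph1 polyD) -rmorphN; apply: laurent_poly.
(* [realizable_sym] puts the upper block in the Z half, where it cancels [G1]; the lower block
   induced in the X half fixes [1 0]. *)
have rE2 := realizable_sym (realizable_upper LT).
have rE := realizableM rE1 rE2.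
set E := (X in realizable X _) in rE; set E' := (X in realizable _ X) in rE.
have h2EE : h2 *m E = row_mx 1%:M 0.
  by rewrite /E mulmxA h2E mul_row_block !simp.
have h1EE : h1 *m E' = block_mx (row_mx 1%:M 0) 0 0 G2.
  rewrite /E' mulmxA h1E mul_row_block !simp mul_block_col !simp.
  rewrite add_col_mx addNr add0r [RHS]block_mxEh; congr row_mx.
  by rewrite /block_mx row_mx0.
have [R2 LR2 G2R] : exists2 R : 'M_(m, a), laurent_mx R & G2 *m R = 1%:M.
  have [R LR] := laurent_right_inv_mulmx (realizable_sym rE) inv1.
  rewrite h1EE -[R]submxK mulmx_block !simp scalar_mx_block => /eq_block_mx[_ _ _ RE].
  by exists (drsubmx R) => //; apply: laurent_rsubmx; apply: laurent_dsubmx.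
have am := right_inv_leq G2R; split=> //.
have [E3 [E3' [rE3 G2E]]] := realizable_pid_mx LG2 (ex_intro2 _ _ R2 LR2 G2R).
(* Successive rows: X on the first c qubits, Z on the a qubits from position c + b on, Z on the
   first c + b qubits. Up to order these are Alice's ebit and ancilla rows. *)
pose M := row_mx (row_mx (col_mx 0 1%:M) (col_mx (col_mx 0 (pid_mx a)) 0))
  (row_mx (col_mx (block_mx 1%:M 0 0 0) 0) 0)
  : 'M[ratD]_((c + a) + (c + b), ((c + b) + m) + ((c + b) + m)).
have [s sM] : exists s, fd_run s (block_mx h1 0 0 h2) = M.
  have [s1 run1] := realizable_run rE.
  have [s3 run3] := realizable_run (realizable_lift (c + b) rE3).
  (* Reduce both halves, move [G2] into X, reduce it on the last m qubits, then exchange Z and X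
     everywhere. *)
  exists (s1 ++ map (@fd_lift (c + b) m) (hadamards m) ++ s3 ++ hadamards _).
  rewrite !fd_run_cat block_mxEh run1 !mul_col_mx !simp h1EE h2EE.
  have -> : col_mx (block_mx (row_mx 1%:M 0) 0 0 G2) 0 =
    row_mx (col_mx (block_mx 1%:M 0 0 0) 0) (col_mx (col_mx 0 G2) 0)
    :> 'M_((c + a) + (c + b), (c + b) + m).
    rewrite [block_mx _ _ _ G2]block_mxEh -[RHS]block_mxEh /block_mx.
    by congr col_mx; rewrite row_mx0.
  have -> : col_mx 0 (row_mx 1%:M 0) = row_mx (col_mx 0 1%:M) 0
    :> 'M[ratD]_((c + a) + (c + b), (c + b) + m).
    by rewrite -[X in _ = row_mx _ X](col_mx0 _ (c + a) (c + b) m) -block_mxEh /block_mx row_mx0.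
  have := @fd_run_lift (c + b) m (c + a + (c + b)) (hadamards m)
    (col_mx (block_mx 1%:M 0 0 0) 0) (col_mx 0 1%:M)
    (row_mx (col_mx (col_mx 0 G2) 0) 0).
  rewrite row_mxKl row_mxKr => ->.
  rewrite fd_run_hadamards row_mxKl row_mxKr run3 fd_run_hadamards !mul_row_block !simp.
  by rewrite !mul_col_mx G2E !simp.
exists (fd_run_inv s).
have -> : block_mx h1 0 0 h2 = fd_run (fd_run_inv s) M by rewrite -sM fd_runK.
(* Circuits are linear in the rows, so row spaces may be compared before the circuit is run. *)
suff /submxP[P ->] : (M <= alice_part (unencoded_stab c ((c + b) + m) (m - a)))%MS.
  by rewrite fd_run_mulmx submxMl.
rewrite alice_part_unencoded; set N := col_mx _ _; apply: rows_submx => i.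
have [j Mj] : exists j, forall t,
    M i (lshift _ t) = N j (lshift _ t) /\ M i (rshift _ t) = N j (rshift _ t).
  case: (split_ordP i) => [i' ->|i2 ->]; first case: (split_ordP i') => [i0 ->|i1 ->].
  - exists (lshift _ (rshift c i0)) => t; rewrite row_mxEl row_mxEr.
    rewrite /N !col_mxEu block_mxEdl block_mxEdr; split.
      by case: (split_ordP t) => t' ->; rewrite ?row_mxEl ?row_mxEr !col_mxEu !mxE.
    case: (split_ordP t) => u' ->; rewrite ?row_mxEl ?row_mxEr.
      rewrite col_mxEu; case: (split_ordP u') => u1 ->; rewrite ?block_mxEul ?block_mxEur !mxE //=.
        by rewrite eq_sym.
      by rewrite gtn_eqF // ltn_addr.
    by rewrite !mxE /= gtn_eqF // -addnA ltn_addr.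
  (* The first b ancillas are taken by Z rows of the second block, so this row is ancilla b + i1. *)
  - have lt1 : (b + i1 < c + b + m - (m - a) - c)%N by have := ltn_ord i1; lia.
    exists (rshift _ (Ordinal lt1)) => t; rewrite row_mxEl row_mxEr.
    rewrite /N !col_mxEd row_mxEl row_mxEr; split.
      case: (split_ordP t) => t' ->; rewrite ?row_mxEl ?row_mxEr !col_mxEu.
        by rewrite !mxE /= addnA ltn_eqF // ltn_addr.
      by rewrite col_mxEd !mxE /= addnA eqn_add2l eq_sym ltn_ord andbT.
    case: (split_ordP t) => u' ->; rewrite ?row_mxEl ?row_mxEr; last by rewrite !mxE.
    by rewrite col_mxEu; case: (split_ordP u') => u1 ->; rewrite ?block_mxEdl ?block_mxEdr !mxE.
  - have X0 t : M (rshift (c + a) i2) (rshift (c + b + m) t) = 0.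
      rewrite row_mxEr; case: (split_ordP t) => u' ->; rewrite ?row_mxEl ?row_mxEr.
        by rewrite col_mxEd mxE.
      by rewrite mxE.
    have Z1 t : M (rshift (c + a) i2) (lshift (c + b + m) t) = (t == i2 :> nat)%:R.
      rewrite row_mxEl; case: (split_ordP t) => t' ->; rewrite ?row_mxEl ?row_mxEr.
        by rewrite col_mxEd mxE eq_sym.
      by rewrite col_mxEd mxE /= gtn_eqF // ltn_addr.
    (* Z rows on the first c qubits belong to ebits; those from qubit c on are ancillas, numbered
       from c. *)
    have [i2c|ci2] := ltnP i2 c.
      exists (lshift _ (lshift c (Ordinal i2c))) => t; rewrite X0 Z1.
      by rewrite /N !col_mxEu row_mxEl row_mxEr !mxE.
    have lt2 : (i2 - c < c + b + m - (m - a) - c)%N by have := ltn_ord i2; lia.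
    exists (rshift _ (Ordinal lt2)) => t; rewrite X0 Z1.
    by rewrite /N !col_mxEd row_mxEl row_mxEr !mxE /= subnKC.
exists j => t; case: (split_ordP t) => t' ->; by have [] := Mj t'.
Qed.

(** Row operations absorb the Smith form: with U = A diag(Gamma, 1) and V = B^T(D^-1), the matrices
    U^-1 h1 and V^-1 h2 have normalized product [1 0; 0 0]. *)
Lemma css_encoder_smith n r1 r2 c (hc1 : (c <= r1)%N) (hc2 : (c <= r2)%N)
    (h1 : 'M[ratD]_(r1, n)) (h2 : 'M[ratD]_(r2, n))
    (A : 'M[ratD]_r1) (B : 'M[ratD]_r2) (Gamma : 'M[ratD]_c) :
  (r2 <= n)%N -> laurent_mx h1 -> laurent_mx h2 ->
  (exists2 R, laurent_mx R & h1 *m R = 1%:M) ->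
  (exists2 R, laurent_mx R & h2 *m R = 1%:M) ->
  laurent_unit_mx A -> laurent_unit_mx B -> is_diag_mx Gamma ->
  (forall i : 'I_c, exists l : int, Gamma i i = Dl ^ l) ->
  h1 *m (map_mx conjD h2)^T
    = A *m castmx (subnKC hc1, subnKC hc2) (block_mx Gamma 0 0 0) *m B ->
  (r1 + r2 <= n + c)%N /\ exists s : seq (fd_op n),
    (block_mx h1 0 0 h2 <=
     fd_run s (alice_part (unencoded_stab c n (n + c - (r1 + r2)))))%MS.
Proof.
move=> r2n L1 L2 [R1 LR1 h1R] [R2 LR2 h2R] [LA [A' LA' [AA' A'A]]] [LB [B' LB' [BB' B'B]]].
move=> /is_diag_mxP Gdiag Gpow; move: (subnKC hc1) (subnKC hc2).
have [a r1E] : exists a, r1 = (c + a)%N by exists (r1 - c)%N; rewrite subnKC.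
have [b r2E] : exists b, r2 = (c + b)%N by exists (r2 - c)%N; rewrite subnKC.
have [m nE] : exists m, n = (r2 + m)%N by exists (n - r2)%N; rewrite subnKC.
subst r1 r2 n => e1 e2; rewrite castmx_block_diag_mx => h12.
pose simp := (mulmx1, mul1mx, mul0mx, mulmx0, addr0, add0r).
pose G' : 'M[ratD]_c := diag_mx (\row_i (Gamma i i)^-1).
have GE : Gamma = diag_mx (\row_i Gamma i i).
  apply/matrixP => i j; rewrite !mxE; have [->|nij] := eqVneq i j; first by rewrite mulr1n.
  by rewrite mulr0n Gdiag.
have G0 i : Gamma i i != 0 by have [l ->] := Gpow i; rewrite expfz_neq0 ?Dl_neq0.
have G'G : G' *m Gamma = 1%:M.
  rewrite GE mulmx_diag -diag_const_mx; congr diag_mx; apply/rowP => i; rewrite !mxE.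
  by rewrite mulVf.
have GG' : Gamma *m G' = 1%:M by apply: mulmx1C.
have LG : laurent_mx Gamma.
  move=> i j; have [->|nij] := eqVneq i j; first by have [l ->] := Gpow j; apply: laurent_Dl.
  by rewrite Gdiag //; apply: laurent0.
have LG' : laurent_mx G'.
  move=> i j; rewrite !mxE; have [->|nij] := eqVneq i j; last by rewrite mulr0n; apply: laurent0.
  by have [l ->] := Gpow j; rewrite mulr1n invr_expz; apply: laurent_Dl.
have Lblock (N : 'M[ratD]_c) : laurent_mx N -> laurent_mx (block_mx N 0 0 1%:M : 'M_(c + a)).
  by move=> LN; apply: laurent_block_mx => //; [exact: laurent_mx0.. | exact: laurent_mx1].
(* The identity block makes the factor invertible over the Laurent polynomials, while U [1 0; 0 0]
   is still A [Gamma 0; 0 0]. *)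
pose U := A *m block_mx Gamma 0 0 1%:M; pose U' := block_mx G' 0 0 1%:M *m A'.
have U'U : U' *m U = 1%:M.
  by rewrite mulmxA -(mulmxA _ A') A'A mulmx1 mulmx_block !simp G'G -scalar_mx_block.
have UU' : U *m U' = 1%:M by apply: mulmx1C.
have LU : laurent_mx U by apply: laurent_mxM => //; apply: Lblock.
have LU' : laurent_mx U' by apply: laurent_mxM => //; apply: Lblock.
pose V := (map_mx conjD B)^T; pose V' := (map_mx conjD B')^T.
have VV' : V *m V' = 1%:M by rewrite -trmx_mul -conj_mulmx B'B map_mx1 trmx1.
have V'V : V' *m V = 1%:M by apply: mulmx1C.
have [|||||am [s sub]] := @css_encoder c a b m (U' *m h1) (V' *m h2).
- exact: laurent_mxM.
- by apply: laurent_mxM => //; apply: laurent_trmx; apply: laurent_mx_conj.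
- exists (R1 *m U); first exact: laurent_mxM.
  by rewrite mulmxA -(mulmxA U') h1R mulmx1.
- exists (R2 *m V); last by rewrite mulmxA -(mulmxA V') h2R mulmx1.
  by apply: laurent_mxM => //; apply: laurent_trmx; apply: laurent_mx_conj.
- have -> : (map_mx conjD (V' *m h2))^T = (map_mx conjD h2)^T *m B'.
    rewrite conj_mulmx trmx_mul; congr (_ *m _).
    by apply/matrixP => i j; rewrite !mxE; apply: conjDK.
  rewrite mulmxA -(mulmxA U') h12 -!mulmxA BB' mulmx1 (mulmxA A') A'A mul1mx.
  by rewrite mulmx_block !simp G'G.
split; first by lia.
exists s; have -> : (c + b + m + c - (c + a + (c + b)) = m - a)%N by lia.
apply: submx_trans sub.
have -> : block_mx h1 0 0 h2 = block_mx U 0 0 V *m block_mx (U' *m h1) 0 0 (V' *m h2).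
  by rewrite mulmx_block !simp (mulmxA U) UU' (mulmxA V) VV' !simp.
exact: submxMl.
Qed.

Theorem lemma2 (n k1 k2 c : nat)
    (hk1 : (k1 <= n)%N) (hk2 : (k2 <= n)%N)
    (hc1 : (c <= n - k1)%N) (hc2 : (c <= n - k2)%N)
    (H1 : 'M[poly2]_(n - k1, n)) (H2 : 'M[poly2]_(n - k2, n))
    (hH1 : noncatastrophic_delay_free H1)
    (hH2 : noncatastrophic_delay_free H2)
    (A : 'M[ratD]_(n - k1)) (B : 'M[ratD]_(n - k2)) (Gamma : 'M[ratD]_c)
    (hA : laurent_unit_mx A) (hB : laurent_unit_mx B)
    (hGdiag : is_diag_mx Gamma)
    (hGpow : forall i : 'I_c, exists l : int, Gamma i i = Dl ^ l)
    (hSmith : map_mx polyD H1 *m (map_mx polyDinv H2)^T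
              = A *m castmx (subnKC hc1, subnKC hc2) (block_mx Gamma 0 0 0) *m B) :
  exists enc dec : seq (fd_op (c + n)),
    fd_encoder (k1 + k2 + c - n) (css_check_mx H1 H2) enc /\
    fd_decoder (k1 + k2 + c - n) enc dec.
Proof.
have inv1 := noncatastrophic_right_inv (leq_subr _ _) hH1.
have inv2 := noncatastrophic_right_inv (leq_subr _ _) hH2.
have conjH2 : map_mx polyDinv H2 = map_mx conjD (map_mx polyD H2).
  by apply/matrixP => i j; rewrite !mxE conjD_poly.
rewrite conjH2 in hSmith.
have [le_r [s sub]] := css_encoder_smith (leq_subr _ _) (@laurent_mx_poly _ _ H1)
  (@laurent_mx_poly _ _ H2) inv1 inv2 hA hB hGdiag hGpow hSmith.
have kE : (n + c - (n - k1 + (n - k2)) = k1 + k2 + c - n)%N by lia.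
rewrite kE in sub.
exists (map (@fd_lift c n) s), (fd_run_inv (map (@fd_lift c n) s)); split; last first.
  by apply: fd_decoder_inv; lia.
split.
  rewrite all_map; elim: s {sub} => //= o s ->; rewrite andbT.
  by case: o => *; rewrite /= /is_alice /= ?leq_addr.
(* [le_r] keeps the subtraction in the number of information qubits from truncating, which makes the
   row counts equal. *)
rewrite alice_part_fd_run_lift; apply: row_equiv_submx sub; first by lia.
have [R1 _ H1R] := inv1; have [R2 _ H2R] := inv2.
apply/row_freeP; exists (block_mx R1 0 0 R2).
by rewrite mulmx_block !mulmx0 !mul0mx !addr0 !add0r H1R H2R -scalar_mx_block.
Qed.
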